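(* Let $X=[0,1]$ with the Euclidean metric, $T(x)=2x \bmod 1$, and $\mu$ Lebesgue measure. Let $(r_n)_n$ be a decreasing sequence of positive numbers such that \[ \sum_{n=0}^\infty \frac{1}{2^{2n} r_{2^n}}<\infty. \] Then $(\mu\times\mu)(\liminf_n E_{n,r_n}^T)=1$.
   Context: For $n\in\mathbb{N}$ and $r>0$, $E_{n,r}^{T}:=\{(x,y)\in X\times X : |T^i x- T^j y|<r \text{ for some } 0\le i,j<n\}$; $E_{n,r_n}^T$ is this set with $r=r_n$. *)

(* Defs.v *)
From mathcomp Require Import all_boot all_order all_algebra.
From mathcomp Require Import all_classical all_reals all_analysis.
Set Implicit Arguments. Unset Strict Implicit. Unset Printing Implicit Defensive.
Import Order.TTheory GRing.Theory Num.Theory.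
Local Open Scope classical_set_scope.
Local Open Scope ring_scope.

Definition doubling {R : realType} (x : R) : R :=
  2 * x - (Num.floor (2 * x))%:~R.

Definition Eset {R : realType} (T : R -> R) (n : nat) (r : R) : set (R * R) :=
  [set xy | exists i j : nat, (i < n)%N /\ (j < n)%N /\
     `|iter i T xy.1 - iter j T xy.2| < r].

Definition liminf_set {U : Type} (A : nat -> set U) : set U :=
  \bigcup_(N in [set: nat]) \bigcap_(n in [set k | (N <= k)%N]) A n.

(* Main.v *)
(** Compare the orbits through binary digits. If 2^-l <= r, then T^i x and T^j y
    are r-close as soon as the digits of x from place i on and those of y from
    place j on agree on a block of length l. Count the pairs (i, j), i, j < m,
    for which this block is in addition followed by a mismatch. Each pair occurs
    with probability p = 2^-(l+1). Expanding the indicators in Walsh characters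
    shows that two pairs are independent unless they lie on the same diagonal
    at distance at most l, and then the mismatch makes them incompatible. Hence
    the variance of the count is at most its mean m^2 p, and Chebyshev's
    inequality bounds the probability of no match by 1 / (m^2 p), which is at
    most 4 / (m^2 r) if l is chosen with 2^l r <= 2. Since E_{n,r} increases
    with n and r, applying this with m = 2^(k-1) and r = r_{2^k} and using the
    Borel-Cantelli lemma gives the theorem. *)
Require Import Defs.
From mathcomp Require Import all_boot all_order all_algebra.
From mathcomp Require Import ring lra zify.
Set Implicit Arguments. Unset Strict Implicit. Unset Printing Implicit Defensive.
Import Order.TTheory GRing.Theory Num.Theory.
Local Open Scope ring_scope.

(** * Walsh characters on a finite Boolean cube *)

Section Walsh.
Variables (R : realFieldType) (I : finType).
Implicit Types (G H : {set I}) (u : {ffun I -> bool}).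

Definition walsh G u : R := \prod_(t in G) (-1) ^+ u t.

Lemma walsh0 u : walsh set0 u = 1.
Proof. by rewrite /walsh big_set0. Qed.

(** The sum factors over the coordinates, and a coordinate lying in exactly one of [G] and [H]
    contributes [1 + (-1) = 0]. *)
Lemma sum_walshM G H :
  \sum_u walsh G u * walsh H u = if G == H then 2 ^+ #|I| else 0.
Proof.
have E u : walsh G u * walsh H u =
    \prod_t (-1) ^+ ((t \in G) (+) (t \in H)) ^+ u t :> R.
  rewrite /walsh big_mkcond [X in _ * X]big_mkcond -big_split /=.
  by apply: eq_bigr => t _; case: (t \in G) (t \in H) (u t) => [] [] [] /=; ring.
under eq_bigr do rewrite E.
rewrite -(bigA_distr_bigA
  (fun t (b : bool) => (-1) ^+ ((t \in G) (+) (t \in H)) ^+ b)) /=.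
under eq_bigr do rewrite big_bool /= expr0.
case: eqP => [->|GH].
  under eq_bigr do rewrite addbb expr0 expr1.
  by rewrite prodr_const.
have [t tGH] : exists t, (t \in G) (+) (t \in H).
  apply/existsP; apply: contra_notT GH => /existsPn GH; apply/setP => t.
  by move: (GH t); case: (t \in G) (t \in H) => [] [].
by rewrite (bigD1 t)//= tGH expr1 addNr mul0r.
Qed.

Lemma sum_walsh G : \sum_u walsh G u = if G == set0 then 2 ^+ #|I| else 0.
Proof. by rewrite -sum_walshM; apply: eq_bigr => u _; rewrite walsh0 mulr1. Qed.

End Walsh.

(** * Counting matches between two binary words *)

Section Matches.
Variables (R : realFieldType) (m l : nat).
Implicit Types (i j : 'I_m) (t : 'I_l.+1) (F : {set 'I_l.+1}).
Local Notation L := (m + l.+1)%N.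
Local Notation word := {ffun 'I_L -> bool}.
Implicit Types u v : word.

(** Words of length [L] contain every block: starts are below [m], and a block has [l] agreeing
    digits followed by one mismatch. *)
Lemma place_subproof i t : (i + t < L)%N.
Proof. by have := ltn_ord i; have := ltn_ord t; lia. Qed.

Definition place i t : 'I_L := Ordinal (place_subproof i t).

Lemma place_inj i : injective (place i).
Proof. by move=> s t /(congr1 val)/= /addnI/val_inj. Qed.

(* Demanding a mismatch right after the common block makes overlapping
   matches on the same diagonal mutually exclusive. *)
Definition exact_match i j u v :=
  [forall t, (u (place i t) == v (place j t)) == (t != ord_max)].

Definition sgn_last F : R := (-1) ^+ (ord_max \in F).

(** The indicator is a product over the places [t] of [(1 + s) / 2] with a sign [s]. Expanding it
    gives one term for each set [F] of places; [sgn_last] collects the sign of the mismatch. *)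
Lemma exact_matchE i j u v :
  (exact_match i j u v)%:R = 2 ^- l.+1 * \sum_F
    sgn_last F * walsh R (place i @: F) u * walsh R (place j @: F) v.
Proof.
have -> : (exact_match i j u v)%:R = \prod_t (2^-1 *
    ((-1) ^+ (t == ord_max) * (-1) ^+ u (place i t) * (-1) ^+ v (place j t) + 1))
    :> R.
  have [/forallP ex|/forallPn [t nex]] := boolP (exact_match i j u v).
    rewrite big1// => t _; move: (ex t).
    by case: (t == ord_max) (u (place i t)) (v (place j t)) => [] [] [] //= _; field.
  rewrite (bigD1 t)//=; move: nex.
  by case: (t == ord_max) (u (place i t)) (v (place j t)) => [] [] [] //= _;
    rewrite ?expr0 ?expr1; ring.
rewrite big_split/= prodr_const card_ord exprVn; congr (_ * _).
rewrite bigA_distr; apply: eq_bigr => F _.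
rewrite -big_mkcond /= !big_split /=; congr (_ * _ * _).
- rewrite /sgn_last; have [lF|lF] := boolP (ord_max \in F).
    rewrite (bigD1 ord_max)//= eqxx big1 ?mulr1// => t /andP[_ /negbTE ->].
    by rewrite expr0.
  by rewrite big1// => t tF; case: eqP => // tl; rewrite -tl tF in lF.
- by rewrite /walsh big_imset//= => ? ? _ _ /place_inj.
- by rewrite /walsh big_imset//= => ? ? _ _ /place_inj.
Qed.

(** Only [F = set0] survives, since a nontrivial character sums to zero. *)
Lemma sum_exact_match i j :
  \sum_u \sum_v (exact_match i j u v)%:R = 2 ^- l.+1 * (2 ^+ L) ^+ 2 :> R.
Proof.
under eq_bigr do under eq_bigr do rewrite exact_matchE.
under eq_bigr do rewrite -mulr_sumr exchange_big/=.
rewrite -mulr_sumr exchange_big/=; congr (_ * _).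
under eq_bigr do under eq_bigr do rewrite -mulr_sumr.
under eq_bigr do rewrite -mulr_suml -mulr_sumr.
rewrite (bigD1 set0)//= [X in _ + X]big1 => [|F F0]; last first.
  by rewrite !sum_walsh !imset_eq0 (negbTE F0) !mulr0.
by rewrite !sum_walsh !imset0 eqxx card_ord /sgn_last inE; ring.
Qed.

Lemma place_imset_eq i i' F F' t : t \in F -> place i @: F = place i' @: F' ->
  exists2 t', t' \in F' & (i + t = i' + t')%N.
Proof.
move=> tF E; have := imset_f (place i) tF.
by rewrite E => /imsetP[t' t'F /(congr1 val)/= ?]; exists t'.
Qed.

(* The smallest element of [F] determines the shift. *)
Lemma place_imset_eq_diag i i' j j' F F' : F != set0 ->
  place i @: F = place i' @: F' -> place j @: F = place j' @: F' ->
  (i + j' = i' + j)%N.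
Proof.
move=> /set0Pn[t0 t0F] Ei Ej.
case: (arg_minnP (fun t : 'I_l.+1 => val t) t0F) => t tF tmin.
have [s sF' Es] := place_imset_eq tF Ei.
have [s' s'F' Es'] := place_imset_eq tF Ej.
have [z zF Ez] := place_imset_eq s'F' (esym Ei).
have [z' z'F Ez'] := place_imset_eq sF' (esym Ej).
move: (tmin _ zF) (tmin _ z'F) => /=; lia.
Qed.

(** Distinct pairs have nonpositive covariance: overlapping matches on one diagonal exclude each
    other, and in all other cases orthogonality yields independence. *)
Lemma sum_exact_matchM i j i' j' : (i, j) != (i', j') ->
  \sum_u \sum_v (exact_match i j u v)%:R * (exact_match i' j' u v)%:R
    <= (2 ^- l.+1) ^+ 2 * (2 ^+ L) ^+ 2 :> R.
Proof.
move=> ij.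
have [/andP[/eqP diag /andP[ii' i'i]]|ndiag] :=
    boolP ((i + j' == i' + j)%N && ((i' <= i + l) && (i <= i' + l))%N).
  rewrite big1 => [|u _]; first by rewrite mulr_ge0// exprn_ge0// ?invr_ge0 ?exprn_ge0.
  rewrite big1// => v _; apply/eqP; rewrite -natrM pnatr_eq0 mulnb eqb0.
  apply/negP => /andP[/forallP M /forallP M'].
  have [ltii'|leii'] := ltnP i i'.
    (* The mismatch closing the earlier block sits at this place of the later one, strictly before
       its end, where agreement is demanded. *)
    have tl : (i + l - i' < l.+1)%N by lia.
    move: (M ord_max) (M' (Ordinal tl)).
    have -> : place i' (Ordinal tl) = place i ord_max by apply: val_inj => /=; lia.
    have -> : place j' (Ordinal tl) = place j ord_max by apply: val_inj => /=; lia.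
    rewrite eqxx; have -> : Ordinal tl != ord_max by apply/eqP => /(congr1 val)/=; lia.
    by case: (u _ == v _).
  have {leii'}ltii' : (i' < i)%N.
    rewrite ltn_neqAle leii' andbT; apply: contraNneq ij => E.
    by rewrite xpair_eqE -!val_eqE /=; apply/andP; split; apply/eqP; lia.
  have tl : (i' + l - i < l.+1)%N by lia.
  move: (M' ord_max) (M (Ordinal tl)).
  have -> : place i (Ordinal tl) = place i' ord_max by apply: val_inj => /=; lia.
  have -> : place j (Ordinal tl) = place j' ord_max by apply: val_inj => /=; lia.
  rewrite eqxx; have -> : Ordinal tl != ord_max by apply/eqP => /(congr1 val)/=; lia.
  by case: (u _ == v _).
pose W F F' := sgn_last F * sgn_last F' *
  (\sum_u walsh R (place i @: F) u * walsh R (place i' @: F') u) *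
  (\sum_v walsh R (place j @: F) v * walsh R (place j' @: F') v).
have -> : \sum_u \sum_v (exact_match i j u v)%:R * (exact_match i' j' u v)%:R =
    (2 ^- l.+1) ^+ 2 * \sum_F \sum_F' W F F'.
  under eq_bigr do under eq_bigr do rewrite !exact_matchE mulrACA -expr2 mulr_suml.
  under eq_bigr do rewrite -mulr_sumr exchange_big/=.
  rewrite -mulr_sumr exchange_big/=; congr (_ * _); apply: eq_bigr => F _.
  under eq_bigr do under eq_bigr do rewrite mulr_sumr.
  under eq_bigr do rewrite exchange_big/=.
  rewrite exchange_big/=; apply: eq_bigr => F' _.
  rewrite /W -mulrA mulr_suml mulr_sumr; apply: eq_bigr => u _.
  by rewrite !mulr_sumr; apply: eq_bigr => v _; ring.
(* A nonzero term needs equal images on both sides. If these are nonempty, the two pairs share a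
   diagonal and the blocks share a place, which [ndiag] rules out. *)
have W0 F F' : ~~ ((F == set0) && (F' == set0)) -> W F F' = 0.
  move=> nFF'; rewrite /W !sum_walshM.
  case: eqP => [Ei|]; last by rewrite mulr0 mul0r.
  case: eqP => [Ej|]; last by rewrite mulr0.
  have F0 : F != set0.
    apply: contraNneq nFF' => F0; move/eqP: Ei.
    by rewrite F0 imset0 eq_sym imset_eq0 eqxx.
  have diag := place_imset_eq_diag F0 Ei Ej.
  case/set0Pn: F0 => t tF; have [t' _ tt'] := place_imset_eq tF Ei.
  by have := ltn_ord t; have := ltn_ord t'; move: ndiag; lia.
rewrite (bigD1 set0)//= (bigD1 set0)//= !big1 => [|F F0|F F0]; last 2 first.
- by rewrite big1// => F' _; apply: W0; rewrite (negbTE F0).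
- by apply: W0; rewrite (negbTE F0) andbF.
by rewrite /W !sum_walshM !imset0 eqxx card_ord /sgn_last !inE; lra.
Qed.

Definition no_match u v := [forall i, forall j, ~~ exact_match i j u v].

(* Chebyshev's inequality for the number of exact matches. *)
Lemma sum_no_match_le : (0 < m)%N ->
  \sum_u \sum_v (no_match u v)%:R <= 2 ^+ l.+1 / m%:R ^+ 2 * (2 ^+ L) ^+ 2 :> R.
Proof.
move=> m0; set p : R := 2 ^- l.+1; set N : R := (2 ^+ L) ^+ 2.
have p0 : 0 < p by rewrite invr_gt0 exprn_gt0.
have N0 : 0 < N by rewrite !exprn_gt0.
pose g i j u v : R := (exact_match i j u v)%:R - p.
have gg ij ij' : \sum_u \sum_v g ij.1 ij.2 u v * g ij'.1 ij'.2 u v <=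
    (if ij == ij' then p * N else 0).
  have -> : \sum_u \sum_v g ij.1 ij.2 u v * g ij'.1 ij'.2 u v =
    \sum_u \sum_v (exact_match ij.1 ij.2 u v)%:R * (exact_match ij'.1 ij'.2 u v)%:R
    - p ^+ 2 * N.
    (* An opaque name keeps the constant term an atom while the sums are split. *)
    have [q qE] : {q | q = p ^+ 2} by exists (p ^+ 2).
    have cN : \sum_(u : word) \sum_(v : word) q = q * N.
      rewrite !sumr_const !card_ffun card_bool card_ord /N.
      by rewrite -mulrnA -[LHS]mulr_natr natrM natrX -expr2.
    transitivity (\sum_u \sum_v (
      (exact_match ij.1 ij.2 u v)%:R * (exact_match ij'.1 ij'.2 u v)%:R
      - p * (exact_match ij.1 ij.2 u v)%:R - p * (exact_match ij'.1 ij'.2 u v)%:R + q)).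
      by apply: eq_bigr => u _; apply: eq_bigr => v _; rewrite /g qE; ring.
    under eq_bigr do rewrite big_split/= !sumrB -!mulr_sumr.
    rewrite big_split/= !sumrB -!mulr_sumr !sum_exact_match cN -/p -/N qE; ring.
  case: ifPn => [/eqP <-|ij'N]; last first.
    rewrite subr_le0; apply: sum_exact_matchM.
    by move: ij ij' ij'N => [? ?] [? ?].
  have -> : \sum_u \sum_v
      (exact_match ij.1 ij.2 u v)%:R * (exact_match ij.1 ij.2 u v)%:R = p * N.
    rewrite -(sum_exact_match ij.1 ij.2); apply: eq_bigr => u _; apply: eq_bigr => v _.
    by rewrite -natrM mulnb andbb.
  by rewrite gerBl mulr_ge0// ?exprn_ge0// ltW.
have S2 : \sum_u \sum_v (\sum_(ij : 'I_m * 'I_m) g ij.1 ij.2 u v) ^+ 2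
    <= m%:R ^+ 2 * (p * N).
  have -> : \sum_u \sum_v (\sum_(ij : 'I_m * 'I_m) g ij.1 ij.2 u v) ^+ 2 =
    \sum_(ij : 'I_m * 'I_m) \sum_(ij' : 'I_m * 'I_m)
      \sum_u \sum_v g ij.1 ij.2 u v * g ij'.1 ij'.2 u v.
    under eq_bigr do under eq_bigr do rewrite expr2 mulr_suml.
    under eq_bigr do rewrite exchange_big/=.
    rewrite exchange_big/=; apply: eq_bigr => ij _.
    under eq_bigr do under eq_bigr do rewrite mulr_sumr.
    under eq_bigr do rewrite exchange_big/=.
    by rewrite exchange_big.
  apply: (@le_trans _ _ (\sum_(ij : 'I_m * 'I_m) p * N)).
    apply: ler_sum => ij _.
    apply: le_trans (ler_sum _ (fun ij' _ => gg ij ij')) _.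
    rewrite (bigD1 ij)//= eqxx big1 ?addr0// => ij'.
    by rewrite eq_sym => /negbTE ->.
  by rewrite sumr_const card_prod card_ord -[leLHS]mulr_natl natrM expr2.
have m0' : 0 < m%:R :> R by rewrite ltr0n.
(* Without a match every centred indicator is [- p], so their sum is exactly [- (m ^ 2 * p)]. *)
have B u v : (no_match u v)%:R * (m%:R ^+ 2 * p) ^+ 2 <=
    (\sum_(ij : 'I_m * 'I_m) g ij.1 ij.2 u v) ^+ 2.
  have [nm|_] := boolP (no_match u v); last by rewrite mul0r sqr_ge0.
  rewrite mul1r; have -> : \sum_(ij : 'I_m * 'I_m) g ij.1 ij.2 u v = - (m%:R ^+ 2 * p).
    rewrite (eq_bigr (fun=> - p)) => [|[i j] _]; last first.
      by move/forallP/(_ i)/forallP/(_ j): nm => /negbTE nm; rewrite /g /= nm sub0r.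
    by rewrite sumr_const card_prod card_ord -[LHS]mulr_natl natrM expr2 mulrN.
  by rewrite sqrrN.
have := le_trans (ler_sum _ (fun u _ => ler_sum _ (fun v _ => B u v))) S2.
under eq_bigr do rewrite -mulr_suml.
rewrite -mulr_suml -ler_pdivlMr ?exprn_gt0 ?mulr_gt0 ?exprn_gt0//.
move=> /le_trans; apply.
rewrite le_eqVlt; apply/orP; left; apply/eqP.
rewrite /p; field; by rewrite expf_neq0//= gt_eqF.
Qed.

End Matches.

(* Imported only here because the classical [set0] hides the finite one. *)
From mathcomp Require Import all_classical all_reals all_analysis.
From mathcomp Require Import measurable_realfun.
Local Open Scope classical_set_scope.
Local Open Scope ring_scope.

(** * Binary digits under the doubling map *)

Section Digits.
Variable R : realType.
Implicit Types x y : R.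

Definition digit x (t : nat) : bool := 2^-1 <= iter t doubling x.

Lemma doubling_itv x : 0 <= doubling x < 1.
Proof.
rewrite /doubling; have := floor_itv (2 * x); rewrite intrD => /andP[? ?].
by apply/andP; split; lra.
Qed.

Lemma iter_doubling_itv x n : 0 <= x < 1 -> 0 <= iter n doubling x < 1.
Proof. by case: n => // n _; rewrite iterS doubling_itv. Qed.

Lemma doublingE x : 0 <= x < 1 -> doubling x = 2 * x - (digit x 0)%:R.
Proof.
move=> /andP[x0 x1]; rewrite /doubling /digit /=; congr (_ - _).
have [hx|hx] := lerP 2^-1 x.
  suff /eqP -> : Num.floor (2 * x) == 1 by [].
  by rewrite floor_eq; apply/andP; split; rewrite ?intrD; lra.
suff /eqP -> : Num.floor (2 * x) == 0 by [].
by rewrite floor_eq; apply/andP; split; rewrite ?intrD; lra.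
Qed.

Lemma digitS x t : digit x t.+1 = digit (doubling x) t.
Proof. by rewrite /digit iterSr. Qed.

Lemma digit_iter x i t : digit (iter i doubling x) t = digit x (i + t).
Proof. by rewrite /digit addnC iterD. Qed.

(** When the leading digits agree, doubling multiplies the difference by exactly 2, so each common
    digit halves the bound. *)
Lemma digit_eq_dist n x y : 0 <= x < 1 -> 0 <= y < 1 ->
  (forall t, (t < n)%N -> digit x t = digit y t) -> `|x - y| < 2 ^- n.
Proof.
elim: n x y => [|n IH] x y x01 y01 xy.
  by rewrite expr0 invr1 ltr_norml; lra.
have : `|doubling x - doubling y| < 2 ^- n.
  by apply: IH; rewrite ?doubling_itv// => t tn; rewrite -!digitS xy.
rewrite !doublingE// xy//.
have -> : 2 * x - (digit y 0)%:R - (2 * y - (digit y 0)%:R) = 2 * (x - y) by ring.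
by rewrite normrM ger0_norm// exprS invfM => ?; lra.
Qed.

(** The endpoint is built from the last digit backwards: prefixing the digit [w 0] sends [a] to
    [(a + w 0) / 2]. *)
Lemma digit_itv n (w : nat -> bool) : exists a : R, forall x, 0 <= x < 1 ->
  (forall t, (t < n)%N -> digit x t = w t) -> a <= x < a + 2 ^- n.
Proof.
elim: n w => [|n IH] w.
  by exists 0 => x; rewrite add0r expr0 invr1.
have [a Ha] := IH (fun t => w t.+1); exists ((a + (w 0)%:R) / 2) => x x01 xw.
have /(_ _ _)/andP[|t tn|] := Ha (doubling x); first exact: doubling_itv.
  by rewrite -digitS xw.
by rewrite doublingE// xw// exprS invfM => ? ?; apply/andP; split; lra.
Qed.

End Digits.

(** * Lebesgue measure of the pairs whose orbits stay apart *)

Section Measure.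
Variable R : realType.
Local Notation mu2 := (@lebesgue_measure R \x @lebesgue_measure R)%E.
Local Notation square := (`[0%R, 1%R[ `*` `[0%R, 1%R[ : set (R * R)).

Lemma measurable_doubling : measurable_fun setT (@doubling R).
Proof.
apply: measurable_funB; first exact: measurable_funM.
apply: nondecreasing_measurable => // x y xy.
by rewrite ler_int le_floor// ler_pM2l.
Qed.

Lemma measurable_iter_doubling n : measurable_fun setT (iter n (@doubling R)).
Proof.
elim: n => [|n IH]; first exact: measurable_id.
exact: (measurableT_comp measurable_doubling IH).
Qed.

Lemma measurable_Eset n (r : R) : measurable (Eset (@doubling R) n r).
Proof.
have -> : Eset (@doubling R) n r =
    \bigcup_(i in [set i | (i < n)%N]) \bigcup_(j in [set j | (j < n)%N])
      [set xy | `|iter i doubling xy.1 - iter j doubling xy.2| < r].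
  apply/seteqP; split => [xy [i [j [ni [nj xyr]]]]|xy [i ni [j nj xyr]]].
    by exists i => //; exists j.
  by exists i, j.
apply: bigcup_measurable => i _; apply: bigcup_measurable => j _.
rewrite -[X in measurable X]setTI.
have : measurable_fun [set: R * R]
    (fun xy : R * R => `|iter i doubling xy.1 - iter j doubling xy.2| < r).
  apply: measurable_fun_ltr; last exact: measurable_cst.
  apply: (@measurableT_comp _ _ _ _ _ _ (@Num.norm R R)).
    exact: normr_measurable.
  apply: measurable_funB.
    exact: (measurableT_comp (measurable_iter_doubling i) measurable_fst).
  exact: (measurableT_comp (measurable_iter_doubling j) measurable_snd).
by move=> /(_ measurableT [set true] I).
Qed.

Lemma measurable_square : measurable square.
Proof. exact: measurableX. Qed.

Lemma lebesgue_measure_itvco (a d : R) : 0 <= d ->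
  lebesgue_measure (`[a, (a + d)[ : set R) = d%:E.
Proof.
move=> d0; rewrite lebesgue_measure_itv /= lte_fin.
have [_|] := ltrP a (a + d); first by rewrite -EFinD addrC addKr.
by rewrite gerDl => d0'; congr _%:E; apply/le_anti/andP.
Qed.

Lemma measure_fin_subadditive d (T : measurableType d)
    (mu : {measure set T -> \bar R}) (I : finType) (P : pred I) (F : I -> set T)
    (A : set T) :
  measurable A -> (forall i, measurable (F i)) ->
  (forall x, A x -> exists2 i, P i & F i x) ->
  (mu A <= \sum_(i | P i) mu (F i))%E.
Proof.
move=> mA mF AF.
have [mU leU] : measurable (\big[setU/set0]_(i | P i) F i) /\
    (mu (\big[setU/set0]_(i | P i) F i) <= \sum_(i | P i) mu (F i))%E.
  elim/big_rec2: _ => [|i y U _ [mU leU]]; first by rewrite measure0.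
  split; first exact: measurableU.
  by apply: le_trans (measureU2 _ _ _) _ => //; exact: leeD.
apply: le_trans leU; apply: le_measure; rewrite ?inE// => x /AF[i Pi Fix].
by rewrite (bigD1 i)//=; left.
Qed.

(** Union bound over dyadic squares of side [2 ^- L], one for each pair of words without a match;
    [sum_no_match_le] counts them. *)
Lemma measure_far_dyadic (m l : nat) (r : R) : (0 < m)%N -> 2 ^- l <= r ->
  (mu2 (square `\` Eset doubling m r) <= (2 ^+ l.+1 / m%:R ^+ 2)%:E)%E.
Proof.
move=> m0 lr; set L := (m + l.+1)%N; pose word := {ffun 'I_L -> bool}.
have /choice[a Ha] : forall u : word, exists a : R, forall x, 0 <= x < 1 ->
    [ffun t : 'I_L => digit x t] = u -> a <= x < a + 2 ^- L.
  (* The default [false] is never read: only places below [L] matter. *)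
  move=> u; have [a Ha] := digit_itv R L (fun t => oapp u false (insub t)).
  exists a => x x01 xu; apply: Ha => // t tL.
  by rewrite insubT /= -xu ffunE.
pose P (p : word * word) := no_match p.1 p.2.
pose F (p : word * word) : set (R * R) :=
  `[a p.1, a p.1 + 2 ^- L[ `*` `[a p.2, a p.2 + 2 ^- L[.
have mF p : measurable (F p) by exact: measurableX.
have muF p : mu2 (F p) = ((2 ^+ L) ^- 2)%:E.
  rewrite /F product_measure1E// expr2 invfM EFinM.
  by congr (_ * _)%E; apply: lebesgue_measure_itvco; rewrite invr_ge0 exprn_ge0.
have cover xy : (square `\` Eset doubling m r) xy -> exists2 p, P p & F p xy.
  case: xy => x y [[/= x01 y01] nE].
  rewrite !in_itv /= in x01 y01.
  exists ([ffun t : 'I_L => digit x t], [ffun t : 'I_L => digit y t]); last first.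
    by split; rewrite /= in_itv /=; exact: Ha.
  (* The first [l] places of an exact match already bring the two iterates within [2 ^- l <= r]. *)
  apply/forallP => i; apply/forallP => j; apply/negP => /forallP ex.
  apply: nE; exists (i : nat), (j : nat); do 2!split => //=.
  apply: lt_le_trans lr; apply: digit_eq_dist; rewrite ?iter_doubling_itv// => t tl.
  rewrite !digit_iter; have := ex (Ordinal (ltnW tl : (t < l.+1)%N)).
  by rewrite !ffunE -val_eqE /= ltn_eqF// => /eqP/eqP.
apply: (@le_trans _ _ (\sum_(p | P p) mu2 (F p))%E).
  apply: measure_fin_subadditive => //.
  exact: measurableD measurable_square (measurable_Eset m r).
under eq_bigr do rewrite muF.
rewrite sumEFin lee_fin big_mkcond /=.
have -> : \sum_(p : word * word) (if P p then (2 ^+ L) ^- 2 else 0) =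
    (\sum_(u : word) \sum_(v : word) (no_match u v)%:R) * (2 ^+ L) ^- 2 :> R.
  rewrite pair_bigA /= mulr_suml; apply: eq_bigr => p _.
  by rewrite /P; case: no_match; rewrite ?mul1r ?mul0r.
rewrite ler_pdivrMr ?exprn_gt0//.
exact: sum_no_match_le.
Qed.

(** The least [l] with [1 / r <= 2 ^ l] works: minimality gives the second bound for [l > 0], and
    [r < 1] gives it for [l = 0]. *)
Lemma dyadic_scale (r : R) : 0 < r < 1 -> exists l, 2 ^- l <= r /\ 2 ^+ l * r <= 2.
Proof.
move=> /andP[r0 r1].
have ex : exists l, r^-1 <= 2 ^+ l.
  exists (Num.bound r^-1).
  have : r^-1 < (Num.bound r^-1)%:R by rewrite archi_boundP// invr_ge0 ltW.
  move=> /ltW/le_trans; apply; rewrite -natrX ler_nat; exact/ltnW/ltn_expl.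
case: (ex_minnP ex) => l lr lmin; exists l; split.
  by rewrite invf_ple ?posrE ?exprn_gt0.
case: l lr lmin => [|l] lr lmin; first by rewrite expr0 mul1r; lra.
have : 2 ^+ l < r^-1 by rewrite ltNge; apply/negP => /lmin; rewrite ltnn.
by rewrite -(ltr_pM2r r0) mulVf ?gt_eqF// exprS; lra.
Qed.

Lemma measure_far (m : nat) (r : R) : (0 < m)%N -> 0 < r ->
  (mu2 (square `\` Eset doubling m r) <= (4 / (m%:R ^+ 2 * r))%:E)%E.
Proof.
move=> m0 r0; have [r1|r1] := ltrP r 1; last first.
  (* Two points of [[0, 1)] are at distance below 1, so the times [i = j = 0] suffice. *)
  have -> : square `\` Eset doubling m r = set0.
    apply/seteqP; split => // -[x y] [[/= ]]; rewrite !in_itv/= => x01 y01.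
    apply; exists 0, 0; do 2!split => //=.
    by apply: lt_le_trans r1; rewrite ltr_norml; lra.
  rewrite measure0 lee_fin divr_ge0// mulr_ge0// ?exprn_ge0//; exact: ltW.
have [l [lr l2]] := @dyadic_scale r (introT andP (conj r0 r1)).
apply: le_trans (measure_far_dyadic m0 lr) _; rewrite lee_fin.
have m0' : 0 < m%:R :> R by rewrite ltr0n.
have -> : 4 / (m%:R ^+ 2 * r) = 4 / r / m%:R ^+ 2 by field; rewrite !gt_eqF.
rewrite ler_pM2r ?invr_gt0 ?exprn_gt0//.
by rewrite ler_pdivlMr// exprS; lra.
Qed.

Lemma Eset_mono (T : R -> R) (m n : nat) (r s : R) : (m <= n)%N -> r <= s ->
  Eset T m r `<=` Eset T n s.
Proof.
move=> mn rs xy [i [j [im [jm xyr]]]]; exists i, j.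
by rewrite (leq_trans im)// (leq_trans jm)// (lt_le_trans xyr).
Qed.

Lemma measurable_liminf_set d (T : measurableType d) (A : nat -> set T) :
  (forall n, measurable (A n)) -> measurable (liminf_set A).
Proof.
move=> mA; apply: bigcup_measurable => N _.
by apply: bigcap_measurableType => n _; exact: mA.
Qed.

(** The flag [b] treats at once the half-open square, on which digits behave well, and the closed
    one of the theorem. *)
Lemma lebesgue2_itv01 (b : bool)
    (I := [set` Interval (BSide true 0) (BSide b 1)] : set R) :
  mu2 (I `*` I) = 1%E.
Proof.
have I1 : lebesgue_measure I = 1%E.
  by rewrite lebesgue_measure_itv/= lte_fin ltr01 sube0.
have mI : measurable I by exact: measurable_itv.
transitivity (lebesgue_measure I * lebesgue_measure I)%E; last by rewrite I1 mule1.
exact: product_measure1E.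
Qed.

End Measure.

(** * Borel-Cantelli along powers of two *)

Theorem mainTheorem7 (R : realType) (r : nat -> R)
  (r_pos : forall n, 0 < r n)
  (r_dec : forall m n, (m <= n)%N -> r n <= r m)
  (hsum : (\sum_(0 <= n <oo) ((2 ^+ (2 * n) * r (2 ^ n)%N)^-1)%:E < +oo)%E) :
  ((@lebesgue_measure R \x @lebesgue_measure R)
     (liminf_set (fun n => Eset doubling n (r n))
        `&` (`[0%R, 1%R] `*` `[0%R, 1%R]))%classic = 1)%E.
Proof.
set mu2 := (_ \x _)%E; set liE := liminf_set _; set cube := _ `*` _.
pose square : set (R * R) := `[0%R, 1%R[ `*` `[0%R, 1%R[.
have mS : measurable square by exact: measurable_square.
have mE n s : measurable (Eset (@doubling R) n s) := measurable_Eset n s.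
have mL : measurable liE by apply: measurable_liminf_set.
have mC : measurable cube by apply: measurableX.
(* Smaller time and smaller radius: for [k > 0], a point of [square] outside [far k] lies in
   [Eset doubling n (r n)] for all [n] from [2 ^ k.-1] to [2 ^ k]. *)
pose far k := square `\` Eset doubling (2 ^ k.-1) (r (2 ^ k)%N).
have mfar k : measurable (far k) by exact: measurableD.
(* One factor 4 comes from [measure_far], the other from [2 ^ k <= 2 * 2 ^ k.-1], which is strict at
   [k = 0]. *)
have far_le k : (mu2 (far k) <= (16%:E * ((2 ^+ (2 * k) * r (2 ^ k)%N)^-1)%:E))%E.
  apply: le_trans (measure_far _ (r_pos _)) _; first by rewrite expn_gt0.
  rewrite -EFinM lee_fin.
  have r0 := r_pos (2 ^ k)%N.
  have k0 : 0 < 2 ^+ k :> R by rewrite exprn_gt0.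
  have k'0 : 0 < 2 ^+ k.-1 :> R by rewrite exprn_gt0.
  have kk : 2 ^+ k <= 2 * 2 ^+ k.-1 :> R.
    by case: (k) => [|k']; rewrite ?expr0 ?exprS//=; lra.
  rewrite natrX ler_pdivrMr ?mulr_gt0 ?exprn_gt0// mulrAC.
  rewrite ler_pdivlMr ?mulr_gt0 ?exprn_gt0//.
  rewrite !mulrA ler_pM2r// mulnC exprM.
  suff : (2 ^+ k) ^+ 2 <= (2 * 2 ^+ k.-1) ^+ 2 :> R by rewrite exprMn; lra.
  by rewrite lerXn2r// nnegrE ?mulr_ge0// ltW.
have far0 : mu2 (lim_sup_set far) = 0.
  apply: lim_sup_set_cvg0 => //.
  apply: le_lt_trans (lee_nneseries
    (fun k _ _ => measure_ge0 _ _) (fun k _ => far_le k)) _.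
  rewrite nneseriesZl => [|k _]; last first.
    by rewrite lee_fin invr_ge0 mulr_ge0 ?exprn_ge0// ltW.
  by rewrite lte_mul_pinfty// ge0_fin_numE// nneseries_ge0// => k _ _;
    rewrite lee_fin invr_ge0 mulr_ge0 ?exprn_ge0// ltW.
have sub : square `\` liE `<=` lim_sup_set far.
  move=> xy [Sxy nL] N _; apply: contrapT => nfar; apply: nL.
  (* If no [far k] with [k >= N] contains the point, every [n >= 2 ^ N] is caught by the dyadic
     range [2 ^ k <= n < 2 ^ k.+1] and the set [far k.+1]. *)
  exists (2 ^ N)%N => // n /= Nn.
  have n0 : (0 < n)%N by rewrite (leq_trans _ Nn)// expn_gt0.
  have := trunc_log_bounds (isT : (1 < 2)%N) n0.
  set k := trunc_log 2 n => /andP[kn nk].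
  have Nk : (N <= k.+1)%N.
    by rewrite -(@leq_exp2l 2)// ltnW// (leq_ltn_trans Nn).
  have : ~ far k.+1 xy by move=> fk; apply: nfar; exists k.+1.
  move=> nf; have {nf} : Eset doubling (2 ^ k) (r (2 ^ k.+1)%N) xy.
    by apply: contrapT => nE; apply: nf; split.
  by apply: Eset_mono => //; apply: r_dec; exact: ltnW.
have SL0 : mu2 (square `\` liE) = 0.
  apply/eqP; rewrite eq_le measure_ge0 andbT -far0.
  apply: le_measure; rewrite ?inE//; first exact: measurableD.
  by apply: bigcapT_measurable => n; apply: bigcup_measurable => k _; exact: mfar.
have SL1 : mu2 (square `&` liE) = 1%E.
  have S1 : mu2 square = 1%E := lebesgue2_itv01 R true.
  have : mu2 square = (mu2 (square `\` liE) + mu2 (square `&` liE))%E.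
    exact: measureDI.
  by rewrite SL0 add0e S1 => <-.
have C1 : mu2 cube = 1%E := lebesgue2_itv01 R false.
(* The set lies between [square] cut with [liE] and [cube], both of measure 1. *)
apply/eqP; rewrite eq_le -{1}C1 -{1}SL1; apply/andP; split.
  by apply: le_measure; rewrite ?inE//; exact: measurableI.
apply: le_measure; rewrite ?inE//; [exact: measurableI|exact: measurableI|].
move=> [x y] [[/= x01 y01] L]; split => //; split; rewrite /= in_itv /=.
  by move: x01; rewrite in_itv /= => /andP[-> /ltW].
by move: y01; rewrite in_itv /= => /andP[-> /ltW].
Qed.
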